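(* Let $(\mathfrak b,\{\cdot,\cdot\})$ be a Banach Lie-Poisson space which splits as a direct sum $\mathfrak b=\mathfrak b_1\oplus\mathfrak b_2$ of closed Banach subspaces. For $j=1,2$ let $R_j:\mathfrak b\to\mathfrak b$ be the projector onto $\mathfrak b_j$ defined by the splitting, $\iota_j:\mathfrak b_j\hookrightarrow\mathfrak b$ the inclusion, and $\pi_j:\mathfrak b\to\mathfrak b_j$ the projection, so that $\iota_j\circ\pi_j=R_j$ and $\pi_j\circ\iota_j=\mathrm{id}_{\mathfrak b_j}$. Assume that $\operatorname{im}R_1^*$ and $\operatorname{im}R_2^*$ are Banach Lie subalgebras of $\mathfrak b^*$. Then: (i) $\mathfrak b_j$ has a Banach Lie-Poisson structure coinduced by $\pi_j$, and the coinduced bracket is $$\{f,g\}_j^{\rm coind}=\{f\circ\pi_j,g\circ\pi_j\}\circ\iota_j ,\qquad f,g\in C^\infty(\mathfrak b_j).$$ The Hamiltonian vector field (with respect to $\{\cdot,\cdot\}_j^{\rm coind}$) of $h\in C^\infty(\mathfrak b_j)$ at $b_j\in\mathfrak b_j$ is $$X_h(b_j)=-\pi_j\big(\operatorname{ad}^*_{\pi_j^*Dh(b_j)}\iota_j(b_j)\big),\qquad j=1,2 .$$ (ii) The Banach space isomorphism $R:=\tfrac12(R_1-R_2):\mathfrak b\to\mathfrak b$ defines a new Banach Lie-Poisson structure $$\{f,g\}_R(b):=\langle[R^*Df(b),Dg(b)]+[Df(b),R^*Dg(b)],b\rangle,\qquad f,g\in C^\infty(\mathfrak b),$$ on $\mathfrak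 b$, which coincides with the product Poisson structure on $\mathfrak b_1\times\overline{\mathfrak b}_2$, where $\mathfrak b_1$ carries $\{\cdot,\cdot\}_1^{\rm coind}$ and $\overline{\mathfrak b}_2$ denotes $\mathfrak b_2$ endowed with the bracket $-\{\cdot,\cdot\}_2^{\rm coind}$. (iii) The inclusions $\iota_1:(\mathfrak b_1,\{\cdot,\cdot\}_1^{\rm coind})\hookrightarrow(\mathfrak b,\{\cdot,\cdot\}_R)$ and $\iota_2:(\mathfrak b_2,-\{\cdot,\cdot\}_2^{\rm coind})\hookrightarrow(\mathfrak b,\{\cdot,\cdot\}_R)$ are linear injective Poisson maps with closed range. (iv) For $j=1,2$, the map $\iota_j$ induces from $(\mathfrak b,\{\cdot,\cdot\}_R)$ a Banach Lie-Poisson structure on $\mathfrak b_j$, which coincides with $(-1)^{j-1}\{\cdot,\cdot\}_j^{\rm coind}$.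
   Context: All spaces are real. A Banach Lie algebra is a Banach space with a continuous bilinear Lie bracket. A Banach Lie-Poisson space is a Banach space $\mathfrak b$ whose dual $\mathfrak b^*$ is a Banach Lie algebra $(\mathfrak b^*,[\cdot,\cdot])$ with $\operatorname{ad}^*_x\mathfrak b\subset\mathfrak b\subset\mathfrak b^{**}$ for all $x\in\mathfrak b^*$, where $\operatorname{ad}_xy=[x,y]$ and $\langle\operatorname{ad}_x^*b,y\rangle=\langle b,[x,y]\rangle$; its Poisson bracket is $\{f,h\}(b)=\langle[Df(b),Dh(b)],b\rangle$ for $f,h\in C^\infty(\mathfrak b)$, where $Df(b)\in\mathfrak b^*$ is the Fréchet derivative. The Hamiltonian vector field $X_h$ is determined by $\langle Df(b),X_h(b)\rangle=\{f,h\}(b)$ for all $f$, i.e. $X_h(b)=-\operatorname{ad}^*_{Dh(b)}b$. A smooth map $\varphi$ between such spaces is Poisson if $\{f,h\}\circ\varphi=\{f\circ\varphi,h\circ\varphi\}$ for all smooth (locally defined) $f,h$ on the target. Coinduced structure: for a continuous linear surjection $\pi:\mathfrak b\to\mathfrak b_1$, the unique Banach Lie-Poisson bracket on $\mathfrak b_1$ (if it exists) making $\pi$ a Poisson map. Induced structure: for a continuous linear injection $\iota:\mathfrak b_1\to\mathfrak b$ with closed range, the unique Banach Lie-Poisson bracket on $\mathfrak b_1$ (if it exists) making $\iota$ a Poisson map. The product Poisson structure of $(\mathfrak b_1,\{\cdot,\cdot\}_1)$ and $(\mathfrak b_2,\{\cdot,\cdot\}_2)$ on $\mathfrak b_1\times\mathfrak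 b_2$ is $\{f,g\}(b_1,b_2)=\{f(\cdot,b_2),g(\cdot,b_2)\}_1(b_1)+\{f(b_1,\cdot),g(b_1,\cdot)\}_2(b_2)$. $\mathfrak b_1\times\mathfrak b_2$ is identified with $\mathfrak b=\mathfrak b_1\oplus\mathfrak b_2$. $R_j^*:\mathfrak b^*\to\mathfrak b^*$ is the dual of $R_j$. *)

(* Defs.v *)
From HB Require Import structures.
From mathcomp Require Import all_boot all_order all_algebra.
From mathcomp Require Import all_classical all_reals all_analysis.
From mathcomp Require Import ring.

Set Implicit Arguments.
Unset Strict Implicit.
Unset Printing Implicit Defensive.

Import Order.TTheory GRing.Theory Num.Theory.
Import numFieldNormedType.Exports.

Local Open Scope classical_set_scope.
Local Open Scope ring_scope.

Section clin_pred.
Context {R : realType} {V W : normedModType R}.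

Definition clin_pred : {pred V -> W} :=
  mem [set f : V -> W | linear f /\ continuous f].

Lemma clin_submod : submod_closed clin_pred.
Proof.
split; first by rewrite inE; split=> [a x y|];
  [rewrite scaler0 addr0|exact: cst_continuous].
move=> a f g; rewrite !inE => -[lf cf] [lg cg]; split.
  by move=> k x y; rewrite !fctE lf lg !scalerDr !scalerA (mulrC k) addrACA.
by move=> x; apply: cvgD; [apply: cvgZl_tmp; exact: cf|exact: cg].
Qed.

HB.instance Definition _ :=
  GRing.isSubmodClosed.Build R (V -> W) clin_pred clin_submod.

End clin_pred.

(* [clin V W] is the Banach space L(V, W) of continuous linear maps, with the
   operator norm [opnorm] below. *)
Record clin (R : realType) (V W : normedModType R) := Clin {
  clin_fun :> V -> W;
  clinP : clin_fun \in clin_pred }.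

Section clin_lmodule.
Context {R : realType} {V W : normedModType R}.

HB.instance Definition _ := [isSub for @clin_fun R V W].
HB.instance Definition _ := [Choice of clin V W by <:].
HB.instance Definition _ := [SubChoice_isSubLmodule of clin V W by <:].

Lemma clin_linear (f : clin V W) : linear f.
Proof. by have := clinP f; rewrite inE => -[]. Qed.

Lemma clin_continuous (f : clin V W) : continuous f.
Proof. by have := clinP f; rewrite inE => -[]. Qed.

HB.instance Definition _ (f : clin V W) :=
  GRing.isLinear.Build R V W *:%R f (clin_linear f).

Lemma clin_eq (f g : clin V W) : f =1 g -> f = g.
Proof. by move=> fg; apply/val_inj/funext. Qed.

Definition opnorm (f : clin V W) : R :=
  inf [set M | 0 <= M /\ forall x, `|f x| <= M * `|x|].

Lemma opnorm_has_inf (f : clin V W) :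
  has_inf [set M | 0 <= M /\ forall x, `|f x| <= M * `|x|].
Proof.
split; last by exists 0 => M [].
have := @clin_continuous f => /linear_bounded_continuous/linear_boundedP.
move=> /pinfty_ex_gt0[M M0 fM].
by exists M; split; first exact: ltW.
Qed.

Lemma opnorm_ge0 f : 0 <= opnorm f.
Proof. by apply: lb_le_inf; [have [] := opnorm_has_inf f|move=> M []]. Qed.

Lemma opnorm_ub (f : clin V W) x : `|f x| <= opnorm f * `|x|.
Proof.
have [->|x0] := eqVneq x 0; first by rewrite linear0 !normr0 mulr0.
have nx0 : 0 < `|x| by rewrite normr_gt0.
rewrite -ler_pdivrMr//; apply: lb_le_inf; first by have [] := opnorm_has_inf f.
by move=> M [_ fM]; rewrite ler_pdivrMr.
Qed.

Lemma opnorm_le (f : clin V W) M :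
  0 <= M -> (forall x, `|f x| <= M * `|x|) -> opnorm f <= M.
Proof. by move=> M0 fM; apply: ge_inf; [have [] := opnorm_has_inf f|]. Qed.

Lemma opnormD (f g : clin V W) : opnorm (f + g) <= opnorm f + opnorm g.
Proof.
apply: opnorm_le => [|x]; first by rewrite addr_ge0 ?opnorm_ge0.
by rewrite mulrDl (le_trans (ler_normD _ _))// lerD ?opnorm_ub.
Qed.

Lemma opnormZ a (f : clin V W) : opnorm (a *: f) = `|a| * opnorm f.
Proof.
have le k (g : clin V W) : opnorm (k *: g) <= `|k| * opnorm g.
  apply: opnorm_le => [|x]; first by rewrite mulr_ge0 ?opnorm_ge0.
  by rewrite -mulrA /= normrZ ler_wpM2l ?opnorm_ub.
apply/eqP; rewrite eq_le le /=.
have [->|a0] := eqVneq a 0; first by rewrite normr0 mul0r opnorm_ge0.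
rewrite mulrC -ler_pdivlMr ?normr_gt0// mulrC -normfV.
by apply: le_trans (le _ _); rewrite scalerA mulVf// scale1r.
Qed.

Lemma opnorm0_eq0 (f : clin V W) : opnorm f = 0 -> f = 0.
Proof.
move=> f0; apply: clin_eq => x; apply/eqP; rewrite -normr_le0.
by rewrite (le_trans (opnorm_ub f x))// f0 mul0r.
Qed.

HB.instance Definition _ :=
  @Lmodule_isNormed.Build R (clin V W) opnorm opnormD opnormZ opnorm0_eq0.

Lemma clin_normE (f : clin V W) : `|f| = opnorm f. Proof. by []. Qed.

Lemma clin_norm_ub (f : clin V W) x : `|f x| <= `|f| * `|x|.
Proof. exact: opnorm_ub. Qed.

End clin_lmodule.

Section clin_complete.
Context {R : realType} {V : normedModType R} {W : completeNormedModType R}.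

Lemma clin_complete (F : set_system (clin V W)) :
  ProperFilter F -> cauchy F -> cvg F.
Proof.
move=> FF /cauchy_ballP Fc.
have Fdist e : 0 < e -> \forall g & h \near F, `|g - h| <= e.
  move=> e0; have := Fc _ e0.
  apply: filterS => -[g h] /=; rewrite -ball_normE /=; exact: ltW.
have Fx x : cvg ((fun g : clin V W => g x) @ F).
  apply: cauchy_cvg; apply/cauchy_ballP => e e0.
  have d0 : 0 < e / 2 / (`|x| + 1) by rewrite !divr_gt0// ltr_wpDl.
  rewrite near_map2; have := Fdist _ d0; apply: filterS => -[g h] /= gh.
  rewrite -ball_normE /=.
  have -> : g x - h x = (g - h) x by [].
  rewrite (le_lt_trans (clin_norm_ub _ _))//.
  rewrite (@le_lt_trans _ _ (e / 2 / (`|x| + 1) * (`|x| + 1)))//.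
    by rewrite ler_pM// lerDl.
  rewrite divfK; first by rewrite ltr_pdivrMr// mulr_natr mulr2n ltrDl.
  by rewrite gt_eqF// ltr_wpDl.
pose f x : W := lim ((fun g : clin V W => g x) @ F).
have fP x : (fun g : clin V W => g x) @ F --> f x by exact: Fx.
have lf : linear f.
  move=> a x y.
  have h : (fun g : clin V W => g (a *: x + y)) @ F --> a *: f x + f y.
    rewrite (_ : (fun g : clin V W => _) =
                 (fun g : clin V W => a *: g x + g y)).
      exact: cvgD (@cvgZl_tmp _ _ _ F _ a _ _ (fP x)) (fP y).
    by apply/funext => g; rewrite linearP.
  exact: cvg_unique (fP (a *: x + y)) h.
have fdist e : 0 < e ->
    F [set g : clin V W | forall x, `|f x - g x| <= e * `|x|].
  move=> e0; have := Fdist _ e0 => /nearP_dep; apply: filterS => g gF x.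
  apply: (@closed_cvg _ _ F FF (fun h : clin V W => h x)
    [set y | `|y - g x| <= e * `|x|]) => //.
    rewrite (_ : [set _ | _] =
      (fun y => `|y - g x|) @^-1` [set y | y <= e * `|x|]) //.
    apply: preimage_closed; last exact: closed_le.
    move=> y _; apply: (@continuous_comp _ _ _ (fun y => y - g x));
      last exact: norm_continuous.
    by apply: cvgB => //; exact: cvg_cst.
  apply: filterS gF => h gh /=.
  rewrite -normrN opprB.
  apply: le_trans (clin_norm_ub (g - h) x) _.
  by rewrite ler_wpM2r.
have [g gP] : exists g : clin V W, forall x, `|f x - g x| <= 1 * `|x|.
  by have [g gP] := filter_ex (fdist 1 ltr01); exists g.
pose fl : {linear V -> W} := HB.pack f (GRing.isLinear.Build R V W *:%R f lf).
have cf : continuous f.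
  apply: (@bounded_linear_continuous _ _ _ fl); apply/linear_boundedP.
  exists (1 + `|g|); split; first exact: num_real.
  move=> r /ltW gr x; rewrite (le_trans _ (ler_wpM2r _ gr))// mulrDl.
  rewrite -[fl x](subrK (g x)) (le_trans (ler_normD _ _))// lerD//.
  exact: clin_norm_ub.
have fin : f \in clin_pred by rewrite inE.
apply/cvg_ex; exists (Clin fin); apply/cvgrPdist_le => e e0.
have := fdist _ e0; apply: filterS => h fh.
by rewrite clin_normE; apply: opnorm_le => //; exact: ltW.
Qed.

HB.instance Definition _ := Uniform_isComplete.Build (clin V W) clin_complete.

End clin_complete.

(* A closed linear subspace; its coercion to a type, [subspace_type], carries
   the restricted norm. *)
Record closedSubspace (R : realType) (V : normedModType R) := ClosedSubspace {
  subspace_set : set V;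
  subspace_submod : submod_closed (mem subspace_set : {pred V});
  subspace_closed : closed subspace_set }.

Section closed_subspace.
Context {R : realType} {V : normedModType R} (S : closedSubspace V).

Definition subspace_pred : {pred V} := mem (subspace_set S).

HB.instance Definition _ :=
  GRing.isSubmodClosed.Build R V subspace_pred (subspace_submod S).

Record subspace_type := InSubspace {
  subspace_val : V;
  subspace_valP : subspace_val \in subspace_pred }.

HB.instance Definition _ := [isSub for subspace_val].
HB.instance Definition _ := [Choice of subspace_type by <:].
HB.instance Definition _ := [SubChoice_isSubLmodule of subspace_type by <:].

Let norm (u : subspace_type) : R := `|subspace_val u|.

Let ler_normD u v : norm (u + v) <= norm u + norm v.
Proof. exact: ler_normD. Qed.

Let normrZ a u : norm (a *: u) = `|a| * norm u.
Proof. exact: normrZ. Qed.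

Let normr0_eq0 u : norm u = 0 -> u = 0.
Proof. by move=> /normr0_eq0 u0; exact: val_inj. Qed.

HB.instance Definition _ :=
  @Lmodule_isNormed.Build R subspace_type norm ler_normD normrZ normr0_eq0.

Lemma subspace_normE (u : subspace_type) : `|u| = `|subspace_val u|.
Proof. by []. Qed.

Lemma subspace_val_continuous : continuous subspace_val.
Proof.
have lf : linear subspace_val by [].
pose f : {linear subspace_type -> V} :=
  HB.pack subspace_val (GRing.isLinear.Build R _ V *:%R subspace_val lf).
apply: (@bounded_linear_continuous _ _ _ f); apply/linear_boundedP.
by exists 1; split=> // r /ltW r1 u; rewrite -[leLHS]mul1r ler_wpM2r.
Qed.

Lemma subspace_val_clin : subspace_val \in @clin_pred R subspace_type V.
Proof. by rewrite inE; split=> //; exact: subspace_val_continuous. Qed.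

Definition subspace_incl : clin subspace_type V := Clin subspace_val_clin.

End closed_subspace.

Section closed_subspace_complete.
Context {R : realType} {V : completeNormedModType R} (S : closedSubspace V).

Lemma subspace_complete (F : set_system (subspace_type S)) :
  ProperFilter F -> cauchy F -> cvg F.
Proof.
move=> FF /cauchy_ballP Fc.
have cF : cvg (@subspace_val _ _ S @ F).
  apply: cauchy_cvg; apply/cauchy_ballP => e e0.
  rewrite near_map2; have := Fc _ e0; apply: filterS => -[u v] /=.
  by rewrite -!ball_normE.
have Sl : (lim (@subspace_val _ _ S @ F)) \in @subspace_pred _ _ S.
  rewrite inE; apply: (@closed_cvg _ _ F FF (@subspace_val _ _ S)
    (subspace_set S)) => //.
    exact: subspace_closed.
  by apply: nearW => u; have := subspace_valP u; rewrite inE.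
apply/cvg_ex; exists (InSubspace Sl); apply/cvgrPdist_le => e e0.
have /cvgrPdist_le/(_ _ e0) := cF; exact: filterS.
Qed.

HB.instance Definition _ :=
  Uniform_isComplete.Build (subspace_type S) subspace_complete.

End closed_subspace_complete.

Coercion subspace_type : closedSubspace >-> Sortclass.

(* The algebraic direct sum condition. The summands are closed in a complete
   space, so the projections are automatically continuous: [split1_clin] and
   [split2_clin] below, by Baire's theorem. *)
Definition direct_sum (R : realType) (V : normedModType R)
    (S1 S2 : closedSubspace V) : Prop :=
  forall x : V, exists! p : S1 * S2,
    x = subspace_incl S1 p.1 + subspace_incl S2 p.2.

Section splitting.
Context {R : realType} {V : completeNormedModType R}.
Context {S1 S2 : closedSubspace V} (hS : direct_sum S1 S2).

Definition split_pair (x : V) : S1 * S2 := projT1 (cid (hS x)).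

Definition split1 x := (split_pair x).1.
Definition split2 x := (split_pair x).2.

Lemma splitE x : subspace_incl S1 (split1 x) + subspace_incl S2 (split2 x) = x.
Proof. by rewrite /split1 /split2 /split_pair; case: cid => p /= [<-]. Qed.

Lemma split_uniq x u v :
  subspace_incl S1 u + subspace_incl S2 v = x -> split1 x = u /\ split2 x = v.
Proof.
rewrite /split1 /split2 /split_pair; case: cid => p /= [_ pu] xE.
by rewrite (pu (u, v)).
Qed.

Let split_lin a x y :
  split1 (a *: x + y) = a *: split1 x + split1 y /\
  split2 (a *: x + y) = a *: split2 x + split2 y.
Proof.
apply: split_uniq; rewrite !linearP.
by rewrite addrACA -scalerDr !splitE.
Qed.

Lemma split1_linear : linear split1.
Proof. by move=> a x y; have [] := split_lin a x y. Qed.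

Lemma split2_linear : linear split2.
Proof. by move=> a x y; have [] := split_lin a x y. Qed.

HB.instance Definition _ :=
  GRing.isLinear.Build R V S1 *:%R split1 split1_linear.
HB.instance Definition _ :=
  GRing.isLinear.Build R V S2 *:%R split2 split2_linear.

Let N x := `|split1 x| + `|split2 x|.

Let NB x y : N (x - y) <= N x + N y.
Proof. by rewrite /N !linearB /= addrACA lerD// ler_normB. Qed.

Let NZ a x : N (a *: x) = `|a| * N x.
Proof. by rewrite /N !linearZ /= !normrZ mulrDr. Qed.

Let split_approx : exists2 C, 0 <= C & forall x e, 0 < e ->
  exists y, N y <= C * `|x| /\ `|x - y| <= e.
Proof.
pose A n := closure [set x | N x <= n%:R].
have [n ndA] : exists n, ~ dense (~` A n).
  apply: contrapT => /forallNP ndA.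
  have := @Baire R V (fun n => ~` A n).
  case/(_ _ setT)=> [n|||x [_ xA]]; last first.
  - have := xA (Num.truncn (N x)).+1 I; apply; apply: subset_closure.
    by rewrite /= ltW// truncnS_gt.
  - exact: openT.
  - by exists 0.
  - split; first exact/closed_openC/closed_closure.
    by have := ndA n; exact: contrapT.
have [U [[x0 [oU Ux0]] UA]] := denseNE ndA.
have /nbhs_ballP[r r0 rU] : nbhs x0 U by exact: open_nbhs_nbhs.
have rA x : `|x| < r -> A n (x0 + x).
  move=> xr; apply: contrapT => nA.
  have : (U `&` ~` A n) (x0 + x).
    split=> //; apply: rU; rewrite -ball_normE /=.
    by rewrite opprD addrA subrr add0r normrN.
  by rewrite UA.
have Az x e : 0 < e -> A n x -> exists2 y, N y <= n%:R & `|x - y| < e.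
  move=> e0 /(_ _ (nbhsx_ballx x e e0)) [y [/= yn]].
  by rewrite -ball_normE /= => ?; exists y.
exists (n.*2%:R * (2 / r)) => [|x e e0];
  first by rewrite mulr_ge0// divr_ge0// ltW.
have [->|x0'] := eqVneq x 0.
  exists 0; split; last by rewrite subrr normr0 ltW.
  by rewrite /N !linear0 !normr0 addr0 mulr0.
have nx : 0 < `|x| by rewrite normr_gt0.
pose t := r / 2 / `|x|.
have t0 : 0 < t by rewrite !divr_gt0.
have te : 0 < t * e / 2 by rewrite divr_gt0// mulr_gt0.
have [|y1 y1n y1x] := Az (x0 + t *: x) _ te.
  apply: rA; rewrite normrZ gtr0_norm// divfK ?gt_eqF//.
  by rewrite ltr_pdivrMr// mulr_natr mulr2n ltrDl.
have [|y2 y2n y2x] := Az (x0 + 0) _ te; first by apply: rA; rewrite normr0.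
have tV : t^-1 = 2 / r * `|x| by rewrite /t !invf_div mulrC.
exists (t^-1 *: (y1 - y2)); split.
  rewrite NZ gtr0_norm ?invr_gt0// tV [leLHS]mulrC -[leRHS]mulrA ler_wpM2r//.
    by rewrite mulr_ge0// divr_ge0// ltW.
  by rewrite (le_trans (NB _ _))// -addnn natrD lerD.
rewrite -[X in `|X - _|](scalerK (lt0r_neq0 t0)) -scalerBr normrZ.
rewrite gtr0_norm ?invr_gt0// ler_pdivrMl//.
have -> : t *: x - (y1 - y2) = (x0 + t *: x - y1) - (x0 + 0 - y2).
  by rewrite addr0 !opprB addrCA -(addrA x0) [RHS]addrC [RHS]addrA subrK.
rewrite (le_trans (ler_normB _ _))// (splitr (t * e)) lerD// ltW//.
Qed.

Let split_bounded : exists2 C, 0 <= C & forall x, N x <= C * `|x|.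
Proof.
have [C C0 CP] := split_approx.
exists (C * 4) => [|x]; first by rewrite mulr_ge0.
have [->|x0] := eqVneq x 0; first by rewrite /N !linear0 !normr0 addr0 mulr0.
have nx : 0 < `|x| by rewrite normr_gt0.
have /choice[g gP] : forall zk : V * nat, exists y,
    N y <= C * `|zk.1| /\ `|zk.1 - y| <= `|x| / 2 ^+ zk.2.+1.
  by move=> [z k] /=; apply: CP; rewrite divr_gt0// exprn_gt0.
pose fix xs k := if k is k'.+1 then xs k' - g (xs k', k') else x.
pose y k := g (xs k, k).
have xsP k : `|xs k| <= `|x| / 2 ^+ k.
  by case: k => [|k] /=; [rewrite expr0 divr1|have [] := gP (xs k, k)].
have yP k : N (y k) <= geometric (C * `|x|) 2^-1 k.
  have [+ _] := gP (xs k, k) => /le_trans; apply => /=.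
  by rewrite -mulrA ler_wpM2l// exprVn xsP.
have xs0 : xs @ \oo --> 0.
  apply/norm_cvg0P.
  apply: (@squeeze_cvgr _ _ _ _ (cst 0) (geometric `|x| 2^-1)).
  - by apply: nearW => k /=; rewrite normr_ge0 exprVn xsP.
  - exact: cvg_cst.
  - by apply: cvg_geometric; rewrite gtr0_norm ?invr_gt0// invf_lt1// ltr1n.
have sumy n : \sum_(0 <= k < n) y k = x - xs n.
  elim: n => [|n IH]; first by rewrite big_nil /= subrr.
  by rewrite big_nat_recr//= IH opprB addrA addrAC.
have half : `|2^-1 : R| < 1 by rewrite gtr0_norm ?invr_gt0// invf_lt1// ltr1n.
have geoB n : \sum_(0 <= k < n) geometric (C * `|x|) 2^-1 k <= C * `|x| * 2.
  have -> : \sum_(0 <= k < n) geometric (C * `|x|) 2^-1 k =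
            C * `|x| * 2 * (1 - 2^-1 ^+ n).
    elim: n => [|n IH]; first by rewrite big_nil expr0 subrr mulr0.
    rewrite big_nat_recr//= IH exprS /geometric /=; by field.
  by rewrite ler_piMr ?mulr_ge0// gerBl exprn_ge0// invr_ge0.
have lims (S : closedSubspace V) (p : {linear V -> S}) :
    (forall z, `|p z| <= N z) ->
    exists2 u : S, (fun n => p (\sum_(0 <= k < n) y k)) @ \oo --> u &
      `|u| <= C * `|x| * 2.
  move=> pN.
  have pE : (fun n => p (\sum_(0 <= k < n) y k)) = series (p \o y).
    by apply/funext => n; rewrite linear_sum.
  have cs : cvg (series (p \o y) @ \oo).
    apply: normed_cvg; apply: (@series_le_cvg _ _ (geometric (C * `|x|) 2^-1)).
    - by move=> k; exact: normr_ge0.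
    - by move=> k; rewrite (le_trans _ (yP k))// addr_ge0.
    - by move=> k; exact: le_trans (pN _) (yP k).
    - exact: is_cvg_geometric_series.
  exists (lim (series (p \o y) @ \oo)); first by rewrite pE.
  apply: (@closed_cvg _ _ \oo _ (series (p \o y))
    [set u | `|u| <= C * `|x| * 2]) => //.
    apply: (@preimage_closed _ _ (fun u : S => `|u|)
      [set r | r <= C * `|x| * 2]).
      by move=> u _; exact: norm_continuous.
    exact: closed_le.
  apply: nearW => n /=; rewrite /series /=.
  rewrite (le_trans (ler_norm_sum _ _ _))// (le_trans _ (geoB n))//.
  by apply: ler_sum => k _; exact: le_trans (pN _) (yP k).
have [|u ulim uC] := lims S1 split1; first by move=> z; rewrite lerDl.
have [|v vlim vC] := lims S2 split2; first by move=> z; rewrite lerDr.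
have uv : subspace_incl S1 u + subspace_incl S2 v = x.
  have h1 : (fun n => x - xs n) @ \oo -->
      subspace_incl S1 u + subspace_incl S2 v.
    rewrite (_ : (fun n => _) = (fun n =>
      subspace_incl S1 (split1 (\sum_(0 <= k < n) y k)) +
      subspace_incl S2 (split2 (\sum_(0 <= k < n) y k)))); last first.
      by apply/funext => n; rewrite splitE sumy.
    apply: cvgD.
      exact: (cvg_comp _ _ ulim (@clin_continuous _ _ _ (subspace_incl S1) u)).
    exact: (cvg_comp _ _ vlim (@clin_continuous _ _ _ (subspace_incl S2) v)).
  have h2 : (fun n => x - xs n) @ \oo --> x - 0.
    by apply: cvgB => //; exact: cvg_cst.
  by rewrite subr0 in h2; exact: cvg_unique h1 h2.
have [xu xv] := split_uniq uv.
by rewrite /N xu xv (le_trans (lerD uC vC))// -mulrDr -natrD mulrAC.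
Qed.

Lemma split1_clin : split1 \in @clin_pred R V S1.
Proof.
rewrite inE; split; first exact: split1_linear.
have [C C0 CP] := split_bounded.
apply: bounded_linear_continuous; apply/linear_boundedP.
exists C; split=> [|r /ltW Cr x]; first exact: num_real.
by rewrite (le_trans _ (ler_wpM2r _ Cr))// (le_trans _ (CP x))// lerDl.
Qed.

Lemma split2_clin : split2 \in @clin_pred R V S2.
Proof.
rewrite inE; split; first exact: split2_linear.
have [C C0 CP] := split_bounded.
apply: bounded_linear_continuous; apply/linear_boundedP.
exists C; split=> [|r /ltW Cr x]; first exact: num_real.
by rewrite (le_trans _ (ler_wpM2r _ Cr))// (le_trans _ (CP x))// lerDr.
Qed.

Definition dsum_pi1 : clin V S1 := Clin split1_clin.
Definition dsum_pi2 : clin V S2 := Clin split2_clin.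

End splitting.

Section clin_comp.
Context {R : realType} {U V W : normedModType R}.

Lemma clin_comp_subproof (g : clin V W) (f : clin U V) :
  g \o f \in @clin_pred R U W.
Proof.
rewrite inE; split=> [a x y|x]; first by rewrite /= !linearP.
by apply: continuous_comp; exact: clin_continuous.
Qed.

Definition clin_comp (g : clin V W) (f : clin U V) : clin U W :=
  Clin (clin_comp_subproof g f).

End clin_comp.

Definition dual (R : realType) (V : normedModType R) := clin V R.

Definition adjoint (R : realType) (V W : normedModType R) (T : clin V W) :
  dual W -> dual V := fun x => clin_comp x T.

Definition dsum_R1 (R : realType) (V : completeNormedModType R)
    (S1 S2 : closedSubspace V) (hS : direct_sum S1 S2) : clin V V :=
  clin_comp (subspace_incl S1) (dsum_pi1 hS).

Definition dsum_R2 (R : realType) (V : completeNormedModType R)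
    (S1 S2 : closedSubspace V) (hS : direct_sum S1 S2) : clin V V :=
  clin_comp (subspace_incl S2) (dsum_pi2 hS).

(* The Frechet derivative as an element of L(V, W); the value 0 is junk, never
   taken where [f] is differentiable (see [fderivE]). *)
Definition fderiv (R : realType) (V W : normedModType R) (f : V -> W) (x : V) :
    clin V W :=
  match pselect (('d f x : V -> W) \in clin_pred) with
  | left h => Clin h
  | right _ => 0
  end.

Lemma fderivE (R : realType) (V W : normedModType R) (f : V -> W) (x : V) :
  differentiable f x -> fderiv f x = 'd f x :> (V -> W).
Proof.
move=> df; rewrite /fderiv; case: pselect => // -[].
rewrite inE; split; first exact: linearP.
exact: diff_continuous.
Qed.

(* [f] is of class C^n on the open set [U]: the derivative of order n takes its
   values in L(V, L(V, ... L(V, W))), with the operator norm topology. *)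
Fixpoint Ck_on (n : nat) (R : realType) (V W : normedModType R)
    (U : set V) (f : V -> W) {struct n} : Prop :=
  match n with
  | 0%N => forall x, U x -> {for x, continuous f}
  | m.+1 => (forall x, U x -> differentiable f x) /\
            @Ck_on m R V (clin V W) U (fderiv f)
  end.

Definition smooth_on (R : realType) (V W : normedModType R)
    (U : set V) (f : V -> W) : Prop :=
  forall n, Ck_on n U f.

Definition smooth (R : realType) (V W : normedModType R) (f : V -> W) : Prop :=
  smooth_on setT f.

Record banach_lie_bracket (R : realType) (E : completeNormedModType R)
    (br : E -> E -> E) : Prop := {
  lie_linearl : forall y, linear (br^~ y);
  lie_linearr : forall x, linear (br x);
  lie_alternating : forall x, br x x = 0;
  lie_jacobi : forall x y z,
    br x (br y z) + br y (br z x) + br z (br x y) = 0;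
  lie_continuous : continuous (fun p : E * E => br p.1 p.2) }.

Definition banach_lie_subalgebra (R : realType) (E : completeNormedModType R)
    (br : E -> E -> E) (A : set E) : Prop :=
  [/\ submod_closed (mem A : {pred E}), closed A &
      forall x y, A x -> A y -> A (br x y)].

Section banach_lie_poisson.
Context {R : realType} {V : completeNormedModType R}.
Implicit Types br : dual V -> dual V -> dual V.

(* The element ad^*_x b of V^** is the image of [c] under V -> V^**. *)
Definition is_coadjoint br (x : dual V) (b c : V) : Prop :=
  forall y : dual V, y c = br x y b.

(* A Banach Lie-Poisson structure on V is given by the Lie bracket of V^*: the
   associated Poisson bracket [poisson_bracket br] determines [br] by its values
   on continuous linear functionals. *)
Definition banach_lie_poisson br : Prop :=
  banach_lie_bracket br /\ forall x b, exists c, is_coadjoint br x b c.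

(* The choice is harmless: continuous linear functionals separate points, so
   there is at most one such element of V. *)
Definition ad_star br (x : dual V) (b : V) : V :=
  get [set c | is_coadjoint br x b c].

Definition poisson_bracket br (f h : V -> R) (b : V) : R :=
  br (fderiv f b) (fderiv h b) b.

Definition is_hamiltonian_vf br (h : V -> R) (X : V -> V) : Prop :=
  forall f : V -> R, smooth f ->
  forall b, fderiv f b (X b) = poisson_bracket br f h b.

Definition opp_bracket br : dual V -> dual V -> dual V := fun x y => - br x y.

End banach_lie_poisson.

Section poisson_map.
Context {R : realType} {V W : completeNormedModType R}.
Variables (brV : dual V -> dual V -> dual V) (brW : dual W -> dual W -> dual W).

(* [f] and [h] range over the smooth functions defined on an open subset [U] of
   the target; their values outside [U] are irrelevant. *)
Definition poisson_map (phi : V -> W) : Prop :=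
  smooth phi /\
  forall (U : set W) (f h : W -> R),
    open U -> smooth_on U f -> smooth_on U h ->
    forall b, U (phi b) ->
      poisson_bracket brW f h (phi b) =
      poisson_bracket brV (f \o phi) (h \o phi) b.

End poisson_map.

Definition is_coinduced (R : realType) (V W : completeNormedModType R)
    (brV : dual V -> dual V -> dual V) (pi : clin V W)
    (brW : dual W -> dual W -> dual W) : Prop :=
  (forall w, exists v, pi v = w) /\
  unique (fun br => banach_lie_poisson br /\ poisson_map brV br pi) brW.

Definition is_induced (R : realType) (V W : completeNormedModType R)
    (brV : dual V -> dual V -> dual V) (iota : clin W V)
    (brW : dual W -> dual W -> dual W) : Prop :=
  [/\ injective iota, closed (range iota) &
      unique (fun br => banach_lie_poisson br /\ poisson_map br brV iota) brW].

Definition product_bracket (R : realType) (V1 V2 : Type)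
    (P1 : (V1 -> R) -> (V1 -> R) -> V1 -> R)
    (P2 : (V2 -> R) -> (V2 -> R) -> V2 -> R)
    (f g : V1 * V2 -> R) (p : V1 * V2) : R :=
  P1 (fun u => f (u, p.2)) (fun u => g (u, p.2)) p.1 +
  P2 (fun v => f (p.1, v)) (fun v => g (p.1, v)) p.2.

(* Main.v *)
(* Write pi_j^* for the adjoint of pi_j. Since iota_j pi_j = R_j, the image of
   R_j^* is that of pi_j^*, so the subalgebra hypothesis says exactly that
   R_j^* fixes [pi_j^* x, pi_j^* y]. Hence iota_j^* [pi_j^* x, pi_j^* y] is a Lie
   bracket on the dual of b_j for which pi_j^* is a morphism; dually, pi_j is
   Poisson. Decomposing x = R_1^* x + R_2^* x and expanding bilinearly,
   [R^* x, y] + [x, R^* y] = [R_1^* x, R_1^* y] - [R_2^* x, R_2^* y], which is the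
   product bracket. A continuous linear map is Poisson as soon as the identity
   of brackets holds on continuous linear functionals, which yields both the
   Poisson maps and the uniqueness claims. Uniqueness of the Hamiltonian vector
   field needs the dual to separate points, i.e. Hahn-Banach. *)
Require Import Defs.
From HB Require Import structures.
From mathcomp Require Import all_boot all_order all_algebra.
From mathcomp Require Import all_classical all_reals all_analysis.
From mathcomp Require Import lra.

Set Implicit Arguments.
Unset Strict Implicit.
Unset Printing Implicit Defensive.

Import Order.TTheory GRing.Theory Num.Theory.
Import numFieldNormedType.Exports.

Local Open Scope classical_set_scope.
Local Open Scope ring_scope.

(** * Hahn-Banach for functionals dominated by the norm *)

Section hahn_banach.
Context {R : realType} {V : normedModType R}.
Implicit Types G : set (V * R).

(* Graph of a partially defined linear functional bounded by the norm: the bound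
   at the points (0, r) and (0, - r) makes the relation single-valued. *)
Definition dominated_graph G :=
  (forall a p q, G p -> G q -> G (a *: p.1 + q.1, a * p.2 + q.2)) /\
  (forall p, G p -> p.2 <= `|p.1|).

(** The one-dimensional extension step: a value at [v] is admissible when it lies above every
    [p.2 - |p.1 - v|] and below every [|q.1 + v| - q.2]. By the triangle inequality each of the
    former is at most each of the latter, so the supremum of the former will do. *)
Lemma dominated_graph_extend G v : dominated_graph G -> G (0, 0) ->
  exists G', [/\ dominated_graph G', G `<=` G' & exists a, G' (v, a)].
Proof.
move=> [Gl Gd] G0.
pose A := [set p.2 - `|p.1 - v| | p in G].
have A0 : A !=set0 by exists (0 - `|0 - v|); exists (0, 0).
have Aub q : G q -> ubound A (`|q.1 + v| - q.2).
  move=> Gq _ [p Gp <-].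
  have := Gd _ (Gl 1 _ _ Gp Gq); rewrite /= scale1r mul1r => pq.
  have := ler_normD (p.1 - v) (q.1 + v).
  rewrite addrACA addNr addr0; lra.
pose a := sup A.
have aub p : G p -> p.2 - `|p.1 - v| <= a.
  move=> Gp; apply: ub_le_sup; last by exists p.
  by exists (`|0 + v| - 0); exact: (Aub (0, 0)).
have alb p : G p -> a <= `|p.1 + v| - p.2.
  by move=> Gp; apply: ge_sup => //; exact: Aub.
have Gs k p : G p -> G (k *: p.1, k * p.2).
  by move=> Gp; have := Gl k _ _ Gp G0; rewrite /= !addr0.
exists [set z | exists p t, G p /\ z = (p.1 + t *: v, p.2 + t * a)]; split.
- split.
    move=> k _ _ [p [t [Gp ->]]] [q [u [Gq ->]]] /=.
    exists (k *: p.1 + q.1, k * p.2 + q.2), (k * t + u).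
    split; first exact: Gl.
    congr pair => /=; last by lra.
    by rewrite scalerDr scalerA scalerDl addrACA.
  move=> _ [p [t [Gp ->]]] /=.
  (* Dividing by [|t|] reduces nonzero [t] to the coefficients [-1] and [1] of [v], where [aub] and
     [alb] apply. *)
  have [t0|t0|->] := ltgtP t 0.
  - have := aub _ (Gs (- t^-1) _ Gp) => /=.
    have nt : 0 < - t by rewrite oppr_gt0.
    have -> : p.1 + t *: v = (- t) *: (- t^-1 *: p.1 - v).
      rewrite scalerBr scalerA mulrNN divff ?lt_eqF// scale1r.
      by rewrite scaleNr opprK.
    rewrite normrZ (gtr0_norm nt) => h.
    have := ler_wpM2l (ltW nt) h.
    rewrite mulrBr mulrA mulrNN divff ?lt_eqF//; lra.
  - have := alb _ (Gs t^-1 _ Gp) => /=.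
    have -> : p.1 + t *: v = t *: (t^-1 *: p.1 + v).
      by rewrite scalerDr scalerA divff ?gt_eqF// scale1r.
    rewrite normrZ (gtr0_norm t0) => h.
    have := ler_wpM2l (ltW t0) h.
    rewrite mulrBr mulrA divff ?gt_eqF//; lra.
  - by rewrite scale0r mul0r !addr0; exact: Gd.
- by move=> [x r] Gx; exists (x, r), 0; rewrite scale0r mul0r !addr0.
- by exists a, (0, 0), 1; rewrite scale1r mul1r !add0r.
Qed.

Lemma dual_norming (v : V) : exists f : dual V, f v = `|v|.
Proof.
(* The guard [G !=set0] lets the empty graph satisfy [P], as the union of the empty chain must;
   comparison with the line [L] then shows that a maximal graph is not empty. *)
pose P G := dominated_graph G /\ (G !=set0 -> G (v, `|v|)).
pose L : set (V * R) := [set z | exists t, z = (t *: v, t * `|v|)].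
have LP : P L.
  split; last by move=> _; exists 1; rewrite scale1r mul1r.
  split.
    move=> a _ _ [t ->] [u ->] /=; exists (a * t + u).
    by rewrite scalerDl mulrDl scalerA mulrA.
  by move=> _ [t ->] /=; rewrite normrZ ler_wpM2r// ler_norm.
have [|G [[[Gl Gd] Gv] Gmax]] := @Zorn_bigcup _ P.
  move=> F FP Ftot; split; last first.
    by move=> [z [X FX Xz]]; exists X => //; apply: (FP _ FX).2; exists z.
  split.
    move=> a p q [X FX Xp] [Y FY Yq].
    have [XY|YX] := Ftot _ _ FX FY.
      by exists Y => //; apply: (FP _ FY).1.1 => //; exact: XY.
    by exists X => //; apply: (FP _ FX).1.1 => //; exact: YX.
  by move=> p [X FX Xp]; exact: (FP _ FX).1.2.
have {}Gv : G (v, `|v|).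
  apply: contrapT => nG; apply: (Gmax L _ LP); split.
    by move=> z Gz; case: nG; apply: Gv; exists z.
  move=> /(_ (v, `|v|)) h; apply: nG; apply: h.
  by exists 1; rewrite scale1r mul1r.
have G0 : G (0, 0).
  by have := Gl (-1) _ _ Gv Gv; rewrite /= scaleN1r mulN1r !addNr.
have GN p : G p -> `|p.2| <= `|p.1|.
  move=> Gp; rewrite ler_norml Gd// andbT.
  have := Gd _ (Gl (-1) _ _ Gp G0).
  by rewrite /= !addr0 scaleN1r mulN1r normrN lerNl.
have Gtot x : exists r, G (x, r).
  have [G' [G'd GG' [a G'x]]] := dominated_graph_extend x (conj Gl Gd) G0.
  exists a; apply: contrapT => nG; apply: (Gmax G'); last first.
    by split=> // _; exact: GG'.
  by split=> // h; apply: nG; exact: h.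
have Gfun x r s : G (x, r) -> G (x, s) -> r = s.
  move=> Gr Gs; have := GN _ (Gl (-1) _ _ Gr Gs).
  rewrite /= scaleN1r addNr normr0 mulN1r normr_le0 addrC subr_eq0.
  by move=> /eqP.
have [f fP] := choice Gtot.
have lf : linear f.
  by move=> a x y; apply: Gfun (fP _) _; exact: (Gl a _ _ (fP x) (fP y)).
pose fl : {linear V -> R} := HB.pack f (GRing.isLinear.Build R V R *:%R f lf).
have cf : continuous f.
  apply: (@bounded_linear_continuous _ _ _ fl); apply/linear_boundedP.
  exists 1; split=> // r /ltW r1 x.
  by rewrite (le_trans (GN _ (fP x)))//= ler_peMl.
have fin : f \in clin_pred by rewrite inE.
by exists (Clin fin); exact: Gfun (fP v) Gv.
Qed.

Lemma dual_separates (u v : V) : (forall f : dual V, f u = f v) -> u = v.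
Proof.
move=> uv; have [f fuv] := dual_norming (u - v).
by apply/eqP; rewrite -subr_eq0 -normr_eq0 -fuv linearB /= uv subrr.
Qed.

End hahn_banach.

(** * Additivity and adjoints of continuous linear maps *)

Section clin_additive.
Context {R : realType} {V W : normedModType R} (f : clin V W).

Lemma clinD x y : f (x + y) = f x + f y. Proof. exact: linearD. Qed.
Lemma clinN x : f (- x) = - f x. Proof. exact: linearN. Qed.
Lemma clinZ a x : f (a *: x) = a *: f x. Proof. exact: linearZ. Qed.
Lemma clin0 : f 0 = 0. Proof. exact: linear0. Qed.

End clin_additive.

Section adjoint.
Context {R : realType} {V W : normedModType R} (T : clin V W).

Lemma adjoint_clinP : adjoint T \in @clin_pred R (dual W) (dual V).
Proof.
have la : linear (adjoint T) by move=> a x y; exact: clin_eq.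
rewrite inE; split=> //.
pose f : {linear dual W -> dual V} :=
  HB.pack (adjoint T) (GRing.isLinear.Build R (dual W) (dual V) *:%R _ la).
apply: (@bounded_linear_continuous _ _ _ f); apply/linear_boundedP.
exists `|T|; split=> [|r /ltW Tr x]; first exact: num_real.
have r0 : 0 <= r by exact: le_trans Tr.
rewrite clin_normE; apply: opnorm_le => [|v]; first by rewrite mulr_ge0.
rewrite (le_trans (clin_norm_ub x (T v)))// mulrAC [leRHS]mulrC ler_wpM2l//.
by rewrite (le_trans (clin_norm_ub T v))// ler_wpM2r.
Qed.

Definition adjoint_clin : clin (dual W) (dual V) := Clin adjoint_clinP.

End adjoint.

(** * Derivatives of continuous linear maps and the chain rule *)

Section smooth_clin.
Context {R : realType}.
Implicit Types V W : normedModType R.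

Lemma is_diff_clin V W (f : clin V W) x : is_diff x f f.
Proof.
apply: DiffDef; first exact/linear_differentiable/clin_continuous.
exact/diff_lin/clin_continuous.
Qed.

Lemma fderiv_is_diff V W (f : V -> W) x (A : clin V W) :
  is_diff x f A -> fderiv f x = A.
Proof.
by move=> [df dfA]; apply: clin_eq => v; rewrite fderivE// dfA.
Qed.

Lemma Ck_on_cst n V W (U : set V) (c : W) : Ck_on n U (cst c).
Proof.
(* The target varies in the induction, since the derivative of a map into [W] takes values in
   [clin V W]. *)
elim: n W c => [|n IH] W c /=; first by move=> x _; exact: cst_continuous.
split=> //; rewrite (_ : fderiv _ = cst 0); first exact: IH.
by apply/funext => x; apply: fderiv_is_diff; exact: is_diff_cst.
Qed.

Lemma smooth_on_clin V W (U : set V) (f : clin V W) : smooth_on U f.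
Proof.
case=> [|n] /=; first by move=> x _; exact: clin_continuous.
split=> [x _|]; first by have [] := is_diff_clin f x.
rewrite (_ : fderiv f = cst f); first exact: Ck_on_cst.
by apply/funext => x; exact/fderiv_is_diff/is_diff_clin.
Qed.

Lemma smooth_on_differentiable V W (U : set V) (f : V -> W) x :
  smooth_on U f -> U x -> differentiable f x.
Proof. by move=> /(_ 1%N)[df _]; exact: df. Qed.

Lemma fderiv_comp V W (f : W -> R) (phi : V -> W) (A : clin V W) x :
  is_diff x phi A -> differentiable f (phi x) ->
  fderiv (f \o phi) x = adjoint A (fderiv f (phi x)).
Proof.
move=> dphi df; apply: fderiv_is_diff.
have dfx : is_diff (phi x) f (fderiv f (phi x)).
  by apply: DiffDef => //; rewrite fderivE.
exact: is_diff_comp.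
Qed.

End smooth_clin.

(** * Lie brackets: opposites, restrictions and products *)

Section lie_bracket.
Context {R : realType} {E : completeNormedModType R}.
Variables (br : E -> E -> E) (Lbr : banach_lie_bracket br).

Lemma lie_brDl x y z : br (x + y) z = br x z + br y z.
Proof. by have := lie_linearl Lbr z 1 x y; rewrite /= !scale1r. Qed.

Lemma lie_brDr x y z : br x (y + z) = br x y + br x z.
Proof. by have := lie_linearr Lbr x 1 y z; rewrite /= !scale1r. Qed.

Lemma lie_br0r x : br x 0 = 0.
Proof. by apply/eqP; rewrite -(inj_eq (addrI (br x 0))) -lie_brDr !addr0. Qed.

Lemma lie_br0l x : br 0 x = 0.
Proof. by apply/eqP; rewrite -(inj_eq (addrI (br 0 x))) -lie_brDl !addr0. Qed.

Lemma lie_brZr a x y : br x (a *: y) = a *: br x y.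
Proof.
by have := lie_linearr Lbr x a y 0; rewrite /= !addr0 lie_br0r addr0.
Qed.

Lemma lie_brZl a x y : br (a *: x) y = a *: br x y.
Proof.
by have := lie_linearl Lbr y a x 0; rewrite /= !addr0 lie_br0l addr0.
Qed.

Lemma lie_brNr x y : br x (- y) = - br x y.
Proof. by rewrite -scaleN1r lie_brZr scaleN1r. Qed.

Lemma lie_brNl x y : br (- x) y = - br x y.
Proof. by rewrite -scaleN1r lie_brZl scaleN1r. Qed.

Lemma lie_antisym x y : br y x = - br x y.
Proof.
apply/eqP; rewrite -addr_eq0; apply/eqP.
have := lie_alternating Lbr (x + y).
by rewrite lie_brDl !lie_brDr !(lie_alternating Lbr) add0r addr0 addrC.
Qed.

Lemma lie_bracket_continuous_comp (E' E'' : completeNormedModType R)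
    (s : clin E' E) (q : clin E E'') :
  continuous (fun p : E' * E' => q (br (s p.1) (s p.2))).
Proof.
move=> p; apply: (@continuous_comp _ _ _ (fun p : E' * E' => br (s p.1) (s p.2)));
  last exact: clin_continuous.
apply: (@continuous_comp _ _ _ (fun p : E' * E' => (s p.1, s p.2))
  (fun p : E * E => br p.1 p.2)); last exact: (lie_continuous Lbr).
apply: cvg_pair.
  apply: (@continuous_comp _ _ _ fst s); last exact: clin_continuous.
  exact: cvg_fst.
apply: (@continuous_comp _ _ _ snd s); last exact: clin_continuous.
exact: cvg_snd.
Qed.

Lemma lie_bracket_opp : banach_lie_bracket (fun x y => - br x y).
Proof.
split.
- by move=> y a x x' /=; rewrite lie_brDl lie_brZl opprD scalerN.
- by move=> x a y y' /=; rewrite lie_brDr lie_brZr opprD scalerN.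
- by move=> x; rewrite (lie_alternating Lbr) oppr0.
- by move=> x y z; rewrite !lie_brNr !opprK (lie_jacobi Lbr).
- by move=> p; apply: continuousN; exact: (lie_continuous Lbr).
Qed.

(** The hypothesis makes the range of [s] closed under brackets. It cancels [s] against [q] inside
    nested brackets, so the Jacobi identity is the image under [q] of that of [br]. *)
Lemma lie_bracket_restrict (E' : completeNormedModType R)
    (s : clin E' E) (q : clin E E') :
  (forall x y, s (q (br (s x) (s y))) = br (s x) (s y)) ->
  banach_lie_bracket (fun x y => q (br (s x) (s y))).
Proof.
move=> sq; split.
- by move=> y a x x' /=; rewrite linearP lie_brDl lie_brZl linearP.
- by move=> x a y y' /=; rewrite linearP lie_brDr lie_brZr linearP.
- by move=> x; rewrite (lie_alternating Lbr) clin0.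
- by move=> x y z; rewrite !sq -!(clinD q) (lie_jacobi Lbr) clin0.
- exact: lie_bracket_continuous_comp.
Qed.

End lie_bracket.

Section lie_bracket_product.
Context {R : realType} {E E1 E2 : completeNormedModType R}.
Variables (br1 : E1 -> E1 -> E1) (br2 : E2 -> E2 -> E2).
Hypotheses (L1 : banach_lie_bracket br1) (L2 : banach_lie_bracket br2).
Variables (q1 : clin E E1) (q2 : clin E E2) (s1 : clin E1 E) (s2 : clin E2 E).
Hypotheses (qs1 : cancel s1 q1) (qs2 : cancel s2 q2).
Hypotheses (qs12 : forall x, q1 (s2 x) = 0) (qs21 : forall x, q2 (s1 x) = 0).

(** The vanishing mixed composites make the ranges of [s1] and [s2] commute, so the Jacobi sum
    separates into those of [br1] and [br2]. *)
Lemma lie_bracket_product :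
  banach_lie_bracket
    (fun x y => s1 (br1 (q1 x) (q1 y)) + s2 (br2 (q2 x) (q2 y))).
Proof.
split.
- move=> y a x x' /=; rewrite !linearP.
  by rewrite (lie_linearl L1) (lie_linearl L2) !linearP addrACA -scalerDr.
- move=> x a y y' /=; rewrite !linearP.
  by rewrite (lie_linearr L1) (lie_linearr L2) !linearP addrACA -scalerDr.
- by move=> x; rewrite (lie_alternating L1) (lie_alternating L2) !clin0 addr0.
- move=> x y z; rewrite !clinD !qs1 !qs2 !qs12 !qs21 !addr0 !add0r.
  rewrite (addrACA (s1 _)) (addrACA (s1 _ + s1 _)) -!(clinD s1) -!(clinD s2).
  by rewrite (lie_jacobi L1) (lie_jacobi L2) !clin0 addr0.
- move=> p; apply: cvgD; exact: lie_bracket_continuous_comp.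
Qed.

End lie_bracket_product.

(** * The coadjoint action and linear Poisson maps *)

Section ad_star.
Context {R : realType} {V : completeNormedModType R}.
Variables (br : dual V -> dual V -> dual V) (blp : banach_lie_poisson br).

Lemma ad_starP x b : is_coadjoint br x b (ad_star br x b).
Proof.
have [c cP] := blp.2 x b.
exact: (@getPex _ [set c | is_coadjoint br x b c] (ex_intro _ c cP)).
Qed.

Lemma banach_lie_poisson_opp : banach_lie_poisson (opp_bracket br).
Proof.
split; first exact: (lie_bracket_opp blp.1).
move=> x b; exists (- ad_star br x b) => y.
by rewrite clinN ad_starP.
Qed.

End ad_star.

Section poisson_clin.
Context {R : realType} {V W : completeNormedModType R}.
Variables (brV : dual V -> dual V -> dual V) (brW : dual W -> dual W -> dual W).
Variable (A : clin V W).

(** A continuous linear functional is smooth and is its own derivative, so it serves as a test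
    function. Conversely, a Poisson bracket at a point depends only on the two derivatives there,
    and the chain rule along [A] acts on these by [adjoint A]. *)
Lemma poisson_map_clin : poisson_map brV brW A <->
  forall x y b, brW x y (A b) = brV (adjoint A x) (adjoint A y) b.
Proof.
split=> [[_ PA] x y b|PA].
  have := PA setT x y openT (@smooth_on_clin _ _ _ _ x)
    (@smooth_on_clin _ _ _ _ y) b I.
  rewrite /poisson_bracket !(fderiv_comp (is_diff_clin A b)).
  - by rewrite !(fderiv_is_diff (is_diff_clin _ _)).
  - by have [] := is_diff_clin y (A b).
  - by have [] := is_diff_clin x (A b).
split; first exact: smooth_on_clin.
move=> U f h oU sf sh b Ub; rewrite /poisson_bracket.
rewrite !(fderiv_comp (is_diff_clin A b)); first exact: PA.
  exact: smooth_on_differentiable sh Ub.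
exact: smooth_on_differentiable sf Ub.
Qed.

End poisson_clin.

(** * Coinduced and induced structures along a retraction *)

Section retract.
Context {R : realType} {V W : completeNormedModType R}.
Variables (iota : clin W V) (pi : clin V W) (iotaK : cancel iota pi).

Lemma adjoint_retractK : cancel (adjoint pi) (adjoint iota).
Proof. by move=> x; apply: clin_eq => w; rewrite /= iotaK. Qed.

(** Uniqueness: [adjoint iota] is onto, with right inverse [adjoint pi], so the Poisson identity for
    [iota] prescribes the bracket on all of [dual W]. *)
Lemma is_induced_retract brV brW : closed (range iota) ->
  banach_lie_poisson brW -> poisson_map brW brV iota ->
  is_induced brV iota brW.
Proof.
move=> cl blpW PW; split=> //; first exact: can_inj iotaK.
split=> // br' [_ P']; apply/funext => x; apply/funext => y; apply: clin_eq => w.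
move/poisson_map_clin: PW => /(_ (adjoint pi x) (adjoint pi y) w).
move/poisson_map_clin: P' => /(_ (adjoint pi x) (adjoint pi y) w).
by rewrite !adjoint_retractK => -> ->.
Qed.

Variables (br : dual V -> dual V -> dual V) (blp : banach_lie_poisson br).
Hypothesis (sub : banach_lie_subalgebra br (range (adjoint (clin_comp iota pi)))).

Definition coind_bracket (x y : dual W) : dual W :=
  adjoint iota (br (adjoint pi x) (adjoint pi y)).

(** The adjoint of [iota \o pi] is a projection whose range contains every [adjoint pi z]. The
    subalgebra hypothesis puts the bracket into this range, where the projection is the identity. *)
Lemma adjoint_coind_bracket x y :
  adjoint pi (coind_bracket x y) = br (adjoint pi x) (adjoint pi y).
Proof.
have im z : range (adjoint (clin_comp iota pi)) (adjoint pi z).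
  by exists (adjoint pi z) => //; apply: clin_eq => v; rewrite /= iotaK.
have [_ _ /(_ _ _ (im x) (im y))[z _ zE]] := sub.
rewrite /coind_bracket -zE.
by apply: clin_eq => v; rewrite /= iotaK.
Qed.

(** Testing [pi c] against [y] amounts to testing [c] against [adjoint pi y], so coadjoint elements
    are pushed down by [pi]. *)
Lemma coind_ad_starP x w :
  is_coadjoint coind_bracket x w (pi (ad_star br (adjoint pi x) (iota w))).
Proof. by move=> y; exact: (ad_starP blp (adjoint pi x) (iota w) (adjoint pi y)). Qed.

Lemma banach_lie_poisson_coind : banach_lie_poisson coind_bracket.
Proof.
split.
  apply: (lie_bracket_restrict blp.1 (s := adjoint_clin pi)
    (q := adjoint_clin iota)).
  exact: adjoint_coind_bracket.
by move=> x w; eexists; exact: coind_ad_starP.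
Qed.

(** Uniqueness: each [w] is [pi (iota w)], so the Poisson identity for [pi] fixes the value at [w]
    of every bracket of functionals. *)
Lemma is_coinduced_coind : is_coinduced br pi coind_bracket.
Proof.
have PC : poisson_map br coind_bracket pi.
  by apply/poisson_map_clin => x y b; rewrite -adjoint_coind_bracket.
split=> [w|]; first by exists (iota w).
split; first by split=> //; exact: banach_lie_poisson_coind.
move=> br' [_ /poisson_map_clin P'].
apply/funext => x; apply/funext => y; apply: clin_eq => w.
by rewrite -[w in RHS]iotaK P'.
Qed.

Lemma coind_poisson_bracketE f g w : smooth f -> smooth g ->
  poisson_bracket coind_bracket f g w =
  poisson_bracket br (f \o pi) (g \o pi) (iota w).
Proof.
move=> sf sg; rewrite /poisson_bracket.
rewrite !(fderiv_comp (is_diff_clin pi _)) ?iotaK//.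
  exact: smooth_on_differentiable sg _.
exact: smooth_on_differentiable sf _.
Qed.

(** The minus sign is antisymmetry: the field must pair with [y] to [[y, Dh]], while [ad_star] at
    [Dh] pairs to [[Dh, y]]. Necessity is tested on linear functionals, which separate points. *)
Lemma coind_hamiltonian_vfE (h : W -> R) (X : W -> W) :
  is_hamiltonian_vf coind_bracket h X <->
  forall w, X w = - pi (ad_star br (adjoint pi (fderiv h w)) (iota w)).
Proof.
have coE (y : dual W) w :
    y (- pi (ad_star br (adjoint pi (fderiv h w)) (iota w))) =
    coind_bracket y (fderiv h w) w.
  rewrite (lie_antisym banach_lie_poisson_coind.1) clinN.
  by rewrite coind_ad_starP.
split=> [HX w|HX f sf w]; last by rewrite HX coE.
apply: dual_separates => y; rewrite coE.
have := HX y (@smooth_on_clin _ _ _ _ y) w.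
by rewrite /poisson_bracket (fderiv_is_diff (is_diff_clin y w)).
Qed.

End retract.

(** * The product structure on a direct sum *)

Section product.
Context {R : realType} {V W1 W2 : completeNormedModType R}.
Variables (iota1 : clin W1 V) (iota2 : clin W2 V).
Variables (pi1 : clin V W1) (pi2 : clin V W2).
Hypotheses (iota1K : cancel iota1 pi1) (iota2K : cancel iota2 pi2).
Hypotheses (pi12 : forall w, pi1 (iota2 w) = 0).
Hypotheses (pi21 : forall w, pi2 (iota1 w) = 0).
Variables (br1 : dual W1 -> dual W1 -> dual W1).
Variables (br2 : dual W2 -> dual W2 -> dual W2).

Definition prod_bracket (x y : dual V) : dual V :=
  adjoint pi1 (br1 (adjoint iota1 x) (adjoint iota1 y)) +
  adjoint pi2 (br2 (adjoint iota2 x) (adjoint iota2 y)).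

Lemma prod_bracketE x y v : prod_bracket x y v =
  br1 (adjoint iota1 x) (adjoint iota1 y) (pi1 v) +
  br2 (adjoint iota2 x) (adjoint iota2 y) (pi2 v).
Proof. by []. Qed.

Lemma banach_lie_poisson_prod :
  banach_lie_poisson br1 -> banach_lie_poisson br2 ->
  banach_lie_poisson prod_bracket.
Proof.
move=> blp1 blp2; split.
  apply: (lie_bracket_product blp1.1 blp2.1
    (q1 := adjoint_clin iota1) (q2 := adjoint_clin iota2)
    (s1 := adjoint_clin pi1) (s2 := adjoint_clin pi2)).
  - exact: adjoint_retractK.
  - exact: adjoint_retractK.
  - by move=> x; apply: clin_eq => w; rewrite /= pi21 clin0.
  - by move=> x; apply: clin_eq => w; rewrite /= pi12 clin0.
move=> x v; exists (iota1 (ad_star br1 (adjoint iota1 x) (pi1 v)) +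
                    iota2 (ad_star br2 (adjoint iota2 x) (pi2 v))) => y.
rewrite clinD.
congr (_ + _).
  exact: (ad_starP blp1 (adjoint iota1 x) (pi1 v) (adjoint iota1 y)).
exact: (ad_starP blp2 (adjoint iota2 x) (pi2 v) (adjoint iota2 y)).
Qed.

Lemma poisson_map_prod1 : poisson_map br1 prod_bracket iota1.
Proof.
apply/poisson_map_clin => x y w.
by rewrite prod_bracketE iota1K pi21 clin0 addr0.
Qed.

Lemma poisson_map_prod2 : poisson_map br2 prod_bracket iota2.
Proof.
apply/poisson_map_clin => x y w.
by rewrite prod_bracketE iota2K pi12 clin0 add0r.
Qed.

Lemma prod_poisson_bracketE (f g : V -> R) (p : W1 * W2) :
  let sum := fun q : W1 * W2 => iota1 q.1 + iota2 q.2 in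
  smooth f -> smooth g ->
  poisson_bracket prod_bracket f g (sum p) =
  product_bracket (poisson_bracket br1) (poisson_bracket br2)
    (f \o sum) (g \o sum) p.
Proof.
move=> sum sf sg.
(* With one argument frozen, [sum] is a translate of an inclusion, so the partial derivatives of
   [h \o sum] are the restrictions of the derivative of [h] to the factors. *)
have d1 : is_diff (p.1) (fun u => iota1 u + iota2 p.2) iota1.
  rewrite -[X in is_diff _ _ X]addr0.
  by apply: is_diffD; exact: is_diff_clin.
have d2 : is_diff (p.2) (fun u => iota1 p.1 + iota2 u) iota2.
  rewrite -[X in is_diff _ _ X]add0r.
  by apply: is_diffD; exact: is_diff_clin.
have E1 (h : V -> R) : smooth h ->
    fderiv (fun u => (h \o sum) (u, p.2)) p.1 = adjoint iota1 (fderiv h (sum p)).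
  move=> sh; apply: (fderiv_comp d1); exact: smooth_on_differentiable sh _.
have E2 (h : V -> R) : smooth h ->
    fderiv (fun u => (h \o sum) (p.1, u)) p.2 = adjoint iota2 (fderiv h (sum p)).
  move=> sh; apply: (fderiv_comp d2); exact: smooth_on_differentiable sh _.
rewrite /product_bracket /poisson_bracket !E1// !E2//.
rewrite prod_bracketE (clinD pi1) (clinD pi2) iota1K iota2K pi12 pi21.
by rewrite addr0 add0r.
Qed.

End product.

(** * Closed subspaces and the projections of the splitting *)

Section subspace_incl.
Context {R : realType} {V : normedModType R} (S : closedSubspace V).

Lemma subspace_incl_inj : injective (subspace_incl S).
Proof. exact: val_inj. Qed.

Lemma closed_range_subspace_incl : closed (range (subspace_incl S)).
Proof.
rewrite (_ : range _ = subspace_set S); first exact: subspace_closed.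
apply/seteqP; split=> [_ [u _ <-]|v Sv] /=.
  by have := subspace_valP u; rewrite inE.
have vS : v \in subspace_pred S by rewrite inE.
by exists (InSubspace vS).
Qed.

End subspace_incl.

Section direct_sum.
Context {R : realType} {V : completeNormedModType R}.
Context {S1 S2 : closedSubspace V} (hS : direct_sum S1 S2).

Lemma dsum_pi1K : cancel (subspace_incl S1) (dsum_pi1 hS).
Proof.
move=> u; have [] // := @split_uniq _ _ _ _ hS (subspace_incl S1 u) u 0.
by rewrite clin0 addr0.
Qed.

Lemma dsum_pi2K : cancel (subspace_incl S2) (dsum_pi2 hS).
Proof.
move=> v; have [] // := @split_uniq _ _ _ _ hS (subspace_incl S2 v) 0 v.
by rewrite clin0 add0r.
Qed.

Lemma dsum_pi1_incl2 v : dsum_pi1 hS (subspace_incl S2 v) = 0.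
Proof.
have [] // := @split_uniq _ _ _ _ hS (subspace_incl S2 v) 0 v.
by rewrite clin0 add0r.
Qed.

Lemma dsum_pi2_incl1 u : dsum_pi2 hS (subspace_incl S1 u) = 0.
Proof.
have [] // := @split_uniq _ _ _ _ hS (subspace_incl S1 u) u 0.
by rewrite clin0 addr0.
Qed.

Lemma dsum_R12 v : dsum_R1 hS v + dsum_R2 hS v = v.
Proof. exact: splitE. Qed.

(** This is the reflection that fixes the first summand and negates the second; it serves to invert
    [Rop], which is half of it. *)
Lemma dsum_reflectionK : involutive (dsum_R1 hS - dsum_R2 hS).
Proof.
move=> v.
suff E u w :
    (dsum_R1 hS - dsum_R2 hS) (subspace_incl S1 u + subspace_incl S2 w) =
    subspace_incl S1 u - subspace_incl S2 w.
  by rewrite -[in RHS](splitE hS v) -[in LHS](splitE hS v) E -clinN E clinN opprK.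
have [u1 w1] := split_uniq hS (erefl (subspace_incl S1 u + subspace_incl S2 w)).
by rewrite -[X in _ = subspace_incl S1 X - _]u1 -[X in _ = _ - subspace_incl S2 X]w1.
Qed.

End direct_sum.

(** * The bracket defined by [R] *)

Section r_bracket.
Context {R : realType} {E : completeNormedModType R}.
Variables (br : E -> E -> E) (Lbr : banach_lie_bracket br).

(** To be used with [xj] and [yj] the images of [x] and [y] under the adjoint of [R_j]. The mixed
    terms [br x1 y2] and [br x2 y1] each occur with coefficients [1/2] and [-1/2], and cancel. *)
Lemma lie_r_bracketE (x1 x2 y1 y2 : E) :
  br (2^-1 *: (x1 - x2)) (y1 + y2) + br (x1 + x2) (2^-1 *: (y1 - y2)) =
  br x1 y1 - br x2 y2.
Proof.
rewrite (lie_brZl Lbr) (lie_brZr Lbr) -scalerDr.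
rewrite !(lie_brDl Lbr, lie_brDr Lbr, lie_brNl Lbr, lie_brNr Lbr).
apply: (canLR (scalerK _)); first by rewrite pnatr_eq0.
rewrite scaler_nat mulr2n [RHS]addrACA [LHS]addrACA; congr (_ + _).
  by rewrite addrACA subrr addr0.
by rewrite addrACA addNr add0r.
Qed.

End r_bracket.

(** * Assertions (i) to (iv) for the splitting *)

Theorem proposition2p2 (R : realType) (b : completeNormedModType R)
    (br : dual b -> dual b -> dual b)
    (b1 b2 : closedSubspace b)
    (br_blp : banach_lie_poisson br)
    (b12 : direct_sum b1 b2)
    (im_R1 : banach_lie_subalgebra br (range (adjoint (dsum_R1 b12))))
    (im_R2 : banach_lie_subalgebra br (range (adjoint (dsum_R2 b12)))) :
  let iota1 := subspace_incl b1 in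
  let iota2 := subspace_incl b2 in
  let pi1 := dsum_pi1 b12 in
  let pi2 := dsum_pi2 b12 in
  let Rop := 2^-1 *: (dsum_R1 b12 - dsum_R2 b12) in
  exists (br1 : dual b1 -> dual b1 -> dual b1)
         (br2 : dual b2 -> dual b2 -> dual b2)
         (brR : dual b -> dual b -> dual b),
  [/\ (* (i) *)
      [/\ is_coinduced br pi1 br1,
          (forall f g : b1 -> R, smooth f -> smooth g -> forall x : b1,
             poisson_bracket br1 f g x =
             poisson_bracket br (f \o pi1) (g \o pi1) (iota1 x)) &
          (forall h : b1 -> R, smooth h -> forall X : b1 -> b1,
             is_hamiltonian_vf br1 h X <->
             forall x : b1,
               X x = - pi1 (ad_star br (adjoint pi1 (fderiv h x)) (iota1 x)))] /\
      [/\ is_coinduced br pi2 br2,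
          (forall f g : b2 -> R, smooth f -> smooth g -> forall x : b2,
             poisson_bracket br2 f g x =
             poisson_bracket br (f \o pi2) (g \o pi2) (iota2 x)) &
          (forall h : b2 -> R, smooth h -> forall X : b2 -> b2,
             is_hamiltonian_vf br2 h X <->
             forall x : b2,
               X x = - pi2 (ad_star br (adjoint pi2 (fderiv h x)) (iota2 x)))],
      (* (ii) *)
      [/\ exists Rinv : clin b b, cancel Rop Rinv /\ cancel Rinv Rop,
          banach_lie_poisson brR,
          (forall f g : b -> R, smooth f -> smooth g -> forall x : b,
             poisson_bracket brR f g x =
             (br (adjoint Rop (fderiv f x)) (fderiv g x) +
              br (fderiv f x) (adjoint Rop (fderiv g x))) x) &
          (forall f g : b -> R, smooth f -> smooth g -> forall p : b1 * b2,
             let sum := fun q : b1 * b2 => iota1 q.1 + iota2 q.2 in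
             poisson_bracket brR f g (sum p) =
             product_bracket (poisson_bracket br1)
                             (poisson_bracket (opp_bracket br2))
                             (f \o sum) (g \o sum) p)],
      (* (iii) *)
      [/\ injective iota1, closed (range iota1) & poisson_map br1 brR iota1] /\
      [/\ injective iota2, closed (range iota2) &
          poisson_map (opp_bracket br2) brR iota2] &
      (* (iv) *)
      is_induced brR iota1 br1 /\ is_induced brR iota2 (opp_bracket br2)].
Proof.
move=> iota1 iota2 pi1 pi2 Rop.
have iota1K : cancel iota1 pi1 by exact: dsum_pi1K.
have iota2K : cancel iota2 pi2 by exact: dsum_pi2K.
have pi12 w : pi1 (iota2 w) = 0 by exact: dsum_pi1_incl2.
have pi21 w : pi2 (iota1 w) = 0 by exact: dsum_pi2_incl1.
pose br1 := coind_bracket iota1 pi1 br.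
pose br2 := coind_bracket iota2 pi2 br.
(* With [brR] taken as the product bracket, its Poisson properties come from the product lemmas, and
   only the formula in [Rop] is left, to [brRE]. *)
pose brR := prod_bracket iota1 iota2 pi1 pi2 br1 (opp_bracket br2).
have blp1 : banach_lie_poisson br1 by exact: banach_lie_poisson_coind.
have blp2 : banach_lie_poisson (opp_bracket br2).
  by apply: banach_lie_poisson_opp; exact: banach_lie_poisson_coind.
have P1 : poisson_map br1 brR iota1 by exact: poisson_map_prod1.
have P2 : poisson_map (opp_bracket br2) brR iota2 by exact: poisson_map_prod2.
have RR (x : dual b) : x = adjoint (dsum_R1 b12) x + adjoint (dsum_R2 b12) x.
  by apply: clin_eq => v; rewrite -[in LHS](dsum_R12 b12 v) clinD.
have RopE x : adjoint Rop x =
    2^-1 *: (adjoint (dsum_R1 b12) x - adjoint (dsum_R2 b12) x).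
  by apply: clin_eq => v; rewrite /= linearZ linearB.
have adj1 x : adjoint (dsum_R1 b12) x = adjoint pi1 (adjoint iota1 x).
  exact: clin_eq.
have adj2 x : adjoint (dsum_R2 b12) x = adjoint pi2 (adjoint iota2 x).
  exact: clin_eq.
have brRE x y : brR x y = br (adjoint Rop x) y + br x (adjoint Rop y).
  rewrite [in X in _ + X](RR x) [in X in X + _](RR y) !RopE.
  rewrite (lie_r_bracketE br_blp.1).
  (* Each adjoint of [R_j] factors through that of [pi_j], a morphism for the coinduced bracket, so
     the two brackets in [dual b] become the two terms of [brR]. *)
  rewrite !adj1 !adj2 -(adjoint_coind_bracket iota1K im_R1).
  rewrite -(adjoint_coind_bracket iota2K im_R2).
  exact: clin_eq.
exists br1, br2, brR; split.
- split; split.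
  + exact: is_coinduced_coind.
  + by move=> f g sf sg x; exact: coind_poisson_bracketE.
  + by move=> h _ X; exact: coind_hamiltonian_vfE.
  + exact: is_coinduced_coind.
  + by move=> f g sf sg x; exact: coind_poisson_bracketE.
  + by move=> h _ X; exact: coind_hamiltonian_vfE.
- split.
  (* [Rop] is [2^-1 *: D] with [D] involutive, hence its inverse is [2 *: D]. *)
  + pose D := dsum_R1 b12 - dsum_R2 b12.
    have DD k l v : k * l = 1 -> (k *: D) ((l *: D) v) = v.
      move=> kl; have -> : (k *: D) ((l *: D) v) = k *: D (l *: D v) by [].
      by rewrite clinZ scalerA kl scale1r dsum_reflectionK.
    exists (2 *: D); split=> v; apply: DD.
      by rewrite mulfV ?pnatr_eq0.
    by rewrite mulVf ?pnatr_eq0.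
  + exact: banach_lie_poisson_prod.
  + by move=> f g _ _ x; rewrite /poisson_bracket brRE.
  + by move=> f g sf sg p; exact: prod_poisson_bracketE.
- split; split=> //; (exact: subspace_incl_inj || exact: closed_range_subspace_incl).
- split; apply: is_induced_retract => //; exact: closed_range_subspace_incl.
Qed.
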